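(* Let $p\in[2,\infty)$ and $q\in(1,2]$ with $\frac1p+\frac1q=1$. Let $\{(\mathbf{x}^{(i)},y^{(i)})\}_{i=1}^n$ with $\mathbf{x}^{(i)}\in\mathbb{R}^d$, $\|\mathbf{x}^{(i)}\|_p\le1$, $y^{(i)}\in\{-1,1\}$, $n\ge2$, and suppose there is $\mathbf{w}^*$ with $\|\mathbf{w}^*\|_q\le1$ and $\min_iy^{(i)}\mathbf{x}^{(i)\top}\mathbf{w}^*\ge\gamma>0$. Let $A$ have rows $y^{(i)}\mathbf{x}^{(i)\top}$, $g(\mathbf{w},\mathbf{p})=\mathbf{p}^{\top}A\mathbf{w}$, $\alpha_t=1$, $\eta^{\mathbf{w}}=\sqrt{\frac{1}{2(q-1)\log n}}$, $\eta^{\mathbf{p}}=1/\eta^{\mathbf{w}}$, $\mathbf{p}_0=\tfrac{\mathbf{1}}{n}$, and $h_j(\mathbf{w})=-g(\mathbf{w},\mathbf{p}_j)$, $\ell_j(\mathbf{p})=g(\mathbf{w}_j,\mathbf{p})$. For $t=1,\dots,T$ let $\mathbf{w}_t=\arg\min_{\mathbf{w}\in\mathbb{R}^d}\eta^{\mathbf{w}}\big[\sum_{j=1}^{t-1}h_j(\mathbf{w})+h_{t-1}(\mathbf{w})\big]+\frac{1}{2(q-1)}\|\mathbf{w}\|_q^2$, and then $\mathbf{p}_t=\arg\min_{\mathbf{p}\in\Delta^n}\eta^{\mathbf{p}}\sum_{s=1}^t\ell_s(\mathbf{p})+D_E(\mathbf{p},\tfrac{\mathbf{1}}{n})$. Let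 $\overline{\mathbf{w}}_T=\frac1T\sum_{s=1}^T\mathbf{w}_s$. Then there is a universal constant $C>0$ such that whenever $T\ge C\sqrt{2(p-1)\log n}/\gamma$, $\overline{\mathbf{w}}_T$ has non-negative margin, i.e. $\min_iy^{(i)}\mathbf{x}^{(i)\top}\overline{\mathbf{w}}_T\ge0$.
   Context: $\Delta^n$ is the probability simplex; $\mathbf{1}$ the all-ones vector; $D_E(\mathbf{p},\mathbf{q})=\sum_ip_i\log(p_i/q_i)$ (KL divergence). (The Bregman divergence of $\frac{1}{2(q-1)}\|\cdot\|_q^2$ from $\mathbf{0}$ equals $\frac{1}{2(q-1)}\|\mathbf{w}\|_q^2$.) *)

(* Defs.v *)
From HB Require Import structures.
From mathcomp Require Import all_boot all_order all_algebra.
From mathcomp Require Import all_classical all_reals all_analysis.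
Set Implicit Arguments. Unset Strict Implicit. Unset Printing Implicit Defensive.
Import Order.TTheory GRing.Theory Num.Theory.
Local Open Scope ring_scope.

Section Defs.
Variable R : realType.

Definition lnorm (d : nat) (r : R) (v : 'I_d -> R) : R :=
  (\sum_(i < d) `|v i| `^ r) `^ (r^-1).

Definition dotp (d : nat) (u v : 'I_d -> R) : R := \sum_(k < d) u k * v k.

Definition simplex (n : nat) (P : 'I_n -> R) : Prop :=
  (forall i, 0 <= P i) /\ \sum_(i < n) P i = 1.

Definition uniform (n : nat) : 'I_n -> R := fun _ => (n%:R)^-1.

(* KL divergence, with the convention 0 log(0/q) = 0 *)
Definition KL (n : nat) (P Q : 'I_n -> R) : R :=
  \sum_(i < n) (if P i == 0 then 0 else P i * ln (P i / Q i)).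

(* g(w, p) = p^T A w, where row i of A is y_i x_i^T *)
Definition gfun (d n : nat) (x : 'I_n -> 'I_d -> R) (y : 'I_n -> R)
  (w : 'I_d -> R) (P : 'I_n -> R) : R :=
  \sum_(i < n) P i * (y i * dotp (x i) w).

Definition is_argmin (T : Type) (S : T -> Prop) (f : T -> R) (z : T) : Prop :=
  S z /\ forall u, S u -> f z <= f u.

End Defs.

(* Main.v *)
Require Import Defs.
From HB Require Import structures.
From mathcomp Require Import all_boot all_order all_algebra.
From mathcomp Require Import all_classical all_reals all_analysis.
From mathcomp Require Import ring lra.
Set Implicit Arguments. Unset Strict Implicit. Unset Printing Implicit Defensive.
Import Order.TTheory GRing.Theory Num.Theory.
Import numFieldNormedType.Exports.
Local Open Scope ring_scope.

(** With [Phi v = |v|_q^2 / (2 (q - 1))], both players minimize a function that is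
1-strongly convex, for the l_q norm and for the l_1 norm respectively. Strong
convexity is only used in midpoint form, which reduces to one-variable
inequalities for [(1 + b)^q + (1 - b)^q] and for the entropy, and implies that
[f v - f z] is at least half the squared distance from [v] to a minimizer [z].

Let [N_t] be the l_1 distance from [P_t] to [P_(t-1)]. The w-player predicts
[P_t] by [P_(t-1)], so (Hoelder) its regret is at most
[Phi wstar / etaw + etaw / 2 * sum N_t^2]. The P-player plays after seeing [w_t],
so its regret against the i-th vertex is at most
[ln n / etap - 1 / (2 etap) * sum N_t^2]. As [etaw * etap = 1] the [N_t] cancel in
the sum of both, which is at most [sqrt (2 (p - 1) ln n)]; hence [C = 1] works. *)

(** * One-variable convexity inequalities around 1 *)

Section Scalar.
Context {R : realType}.
Implicit Types a b c q s x y : R.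

Lemma is_derive_ge0_le (f df : R -> R) b : 0 <= b ->
  (forall x, 0 <= x <= b -> is_derive x 1 f (df x)) ->
  (forall x, 0 <= x <= b -> 0 <= df x) -> f 0 <= f b.
Proof.
move=> b0 fdf df0.
have [x||c + E] := @MVT_segment R f df 0 b b0.
- by rewrite in_itv/= => /andP[? ?]; apply: fdf; rewrite !ltW.
- apply: derivable_within_continuous => x; rewrite in_itv/= => xb.
  by have [] := fdf x xb.
rewrite in_itv/= => cb; rewrite -subr_ge0 E subr0.
by rewrite mulr_ge0// df0.
Qed.

Lemma is_derive_1D (h : R -> R) dh x :
  is_derive (1 + x) 1 h dh -> is_derive x 1 (fun y => h (1 + y)) dh.
Proof.
move=> D; have D1 : is_derive x 1 (fun y => 1 + y) (0 + 1 : R).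
  exact: (is_deriveD (is_derive_cst (1 : R) x 1) (is_derive_id x 1)).
by have := @is_derive1_comp _ h (fun y => 1 + y) x _ _ D D1; rewrite add0r mulr1.
Qed.

Lemma is_derive_1B (h : R -> R) dh x :
  is_derive (1 - x) 1 h dh -> is_derive x 1 (fun y => h (1 - y)) (- dh).
Proof.
move=> D; have D1 : is_derive x 1 (fun y => 1 - y) (0 - 1 : R).
  exact: (is_deriveB (is_derive_cst (1 : R) x 1) (is_derive_id x 1)).
have := @is_derive1_comp _ h (fun y => 1 - y) x _ _ D D1.
by rewrite sub0r mulrN mulr1.
Qed.

(** Integrating the bound on the symmetrized second derivative twice from 0: the first derivative of
    [h (1 + y) + h (1 - y) - c * y ^+ 2] vanishes at 0 and is shown nonnegative. The bound stops
    short of [b = 1], where [1 - b] reaches the boundary of the domain of differentiability. *)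
Lemma second_difference_ge (h h1 h2 : R -> R) c b :
  (forall x, 0 < x -> is_derive x 1 h (h1 x)) ->
  (forall x, 0 < x -> is_derive x 1 h1 (h2 x)) ->
  (forall x, 0 <= x < 1 -> 2 * c <= h2 (1 + x) + h2 (1 - x)) ->
  0 <= b < 1 -> 2 * h 1 + c * b ^+ 2 <= h (1 + b) + h (1 - b).
Proof.
move=> dh dh1 ch2 /andP[b0 b1].
have first_order x : 0 <= x < 1 -> 0 <= h1 (1 + x) - h1 (1 - x) - 2 * c * x.
  move=> /andP[x0 x1].
  pose f y := h1 (1 + y) - h1 (1 - y) - (2 * c) * y.
  suff : f 0 <= f x by rewrite /f addr0 !subr0 subrr mulr0 subr0.
  apply: (@is_derive_ge0_le _ (fun y => h2 (1 + y) + h2 (1 - y) - 2 * c)) => //.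
  - move=> y /andP[y0 yx]; apply: is_derive_eq.
      apply: (is_deriveB (is_deriveB _ _) (is_deriveZ (2 * c) (is_derive_id y 1))).
      + by apply: is_derive_1D; apply: dh1; lra.
      + by apply: is_derive_1B; apply: dh1; lra.
    by rewrite /GRing.scale/= mulr1 opprK.
  - by move=> y /andP[y0 yx]; rewrite subr_ge0 ch2// y0 (le_lt_trans yx).
pose f y := h (1 + y) + h (1 - y) - c * (y * y).
suff : f 0 <= f b by rewrite /f addr0 subr0 !mulr0 expr2; lra.
apply: (@is_derive_ge0_le _ (fun y => h1 (1 + y) - h1 (1 - y) - 2 * c * y)) => //.
- move=> y /andP[y0 yx]; apply: is_derive_eq.
    apply: (is_deriveB (is_deriveD _ _)
      (is_deriveZ c (is_deriveM (is_derive_id y 1) (is_derive_id y 1)))).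
    + by apply: is_derive_1D; apply: dh; lra.
    + by apply: is_derive_1B; apply: dh; lra.
  by rewrite /GRing.scale/= mulr1; ring.
- by move=> y /andP[y0 yb]; rewrite first_order// y0 (le_lt_trans yb).
Qed.

Lemma powR_sum_ge2 a b : a <= 0 -> 0 <= b < 1 ->
  2 <= (1 + b) `^ a + (1 - b) `^ a.
Proof.
move=> a0 /andP[b0 b1].
have u0 : 0 < (1 + b) `^ a by rewrite powR_gt0//; lra.
have v0 : 0 < (1 - b) `^ a by rewrite powR_gt0//; lra.
have uv : 1 <= (1 + b) `^ a * (1 - b) `^ a.
  rewrite -powRM; [|lra..].
  rewrite -[leLHS](powRr0 ((1 + b) * (1 - b))).
  by apply: ger_powR => //; apply/andP; split; nra.
set u := _ `^ a in u0 uv *; set v := _ `^ a in v0 uv *.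
have := sqr_ge0 (u - v); nra.
Qed.

(** The second derivative of the q-th power carries the exponent [q - 2 <= 0], so its symmetrization
    is smallest at 0. The endpoint [b = 1] follows by a limit. *)
Lemma powR_two_point_le1 q b : 1 < q <= 2 -> 0 <= b <= 1 ->
  2 + q * (q - 1) * b ^+ 2 <= (1 + b) `^ q + (1 - b) `^ q.
Proof.
move=> /andP[q1 q2].
have lt1 c : 0 <= c < 1 -> 2 + q * (q - 1) * c ^+ 2 <= (1 + c) `^ q + (1 - c) `^ q.
  move=> c01.
  have -> : 2 = 2 * 1 `^ q :> R by rewrite powR1 mulr1.
  apply: (@second_difference_ge (@powR R ^~ q) (fun x => q * x `^ (q - 1))
    (fun x => q * ((q - 1) * x `^ (q - 1 - 1)))) => //.
  - by move=> x x0; exact: (is_deriveZ q (is_derive1_powR (q - 1) x0)).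
  - move=> x x01; have := @powR_sum_ge2 (q - 1 - 1) x _ x01.
    set u := _ `^ _; set v := _ `^ _ => uv.
    have {}uv : 2 <= u + v by apply: uv; lra.
    have : 0 <= q * (q - 1) by nra.
    nra.
move=> /andP[b0]; rewrite le_eqVlt => /predU1P[->|b1]; last exact/lt1/andP.
rewrite subrr powR0 ?gt_eqF//; last lra.
apply/ler_addgt0Pr => e e0.
(* Replacing 1 by [c] costs at most [4 * (1 - c)] on the left and [1 - c] on the right, hence at
   most [e / 2] in all. *)
have [c [c0 c1 ce]] : exists c, [/\ 0 <= c, c < 1 & 1 - c <= e / 10].
  exists (Num.max 0 (1 - e / 10)); split.
  - by rewrite le_max lexx.
  - by rewrite gt_max ltr01/=; lra.
  - by rewrite lerBlDr -lerBlDl le_max lexx orbT.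
have := lt1 c; rewrite c0 c1 => /(_ isT) H.
have H1 : (1 + c) `^ q <= (1 + 1) `^ q.
  by apply: ge0_ler_powR; rewrite ?nnegrE; lra.
have H2 : (1 - c) `^ q <= 1 - c by apply: ge1r_powR; [apply/andP; split|]; lra.
have K0 : 0 <= q * (q - 1) by nra.
have K2 : q * (q - 1) <= 2 by nra.
move: K0 K2 H; set K := q * (q - 1) => K0 K2 H.
have H3 : K * (1 - c ^+ 2) <= 2 * (2 * (1 - c)).
  by apply: ler_pM => //; [rewrite subr_ge0 expr_le1//; lra|nra].
lra.
Qed.

Lemma entropy_two_point_le1 b : 0 <= b <= 1 ->
  b ^+ 2 <= (1 + b) * ln (1 + b) + (1 - b) * ln (1 - b).
Proof.
move=> /andP[b0]; rewrite le_eqVlt => /predU1P[->|b1].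
  rewrite subrr mul0r addr0 expr1n.
  (* At [b = 1] the claim is [1 <= 2 * ln 2], which follows from [ln (1 / 2) <= - 1 / 2]. *)
  have := @le_ln1Dx R (- 2^-1).
  have -> : 1 + - 2^-1 = 2^-1 :> R by lra.
  rewrite lnV ?posrE//.
  have -> : 1 + 1 = 2 :> R by lra.
  by move=> H; have := H ltac:(lra); lra.
suff : 2 * (1 * ln 1) + 1 * b ^+ 2 <= (1 + b) * ln (1 + b) + (1 - b) * ln (1 - b).
  by rewrite ln1; lra.
apply: (@second_difference_ge (fun x => x * ln x) (fun x => ln x + 1)
    (fun x => x^-1)); last by rewrite b0.
- move=> x x0; apply: is_derive_eq.
    exact: (is_deriveM (is_derive_id x 1) (is_derive1_ln x0)).
  by rewrite /GRing.scale/= mulr1 mulfV ?gt_eqF// addrC.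
- move=> x x0; apply: is_derive_eq.
    exact: (is_deriveD (is_derive1_ln x0) (is_derive_cst (1 : R) x 1)).
  by rewrite addr0.
- move=> x x01; have := @powR_sum_ge2 (-1) x _ x01.
  by case/andP: x01 => ? ?; rewrite !powR_inv1; [|lra..]; move=> H; apply: le_trans (H _); lra.
Qed.
End Scalar.

(** * The sharp two-point inequality for real powers *)

Section PowerMean.
Context {R : realType}.
Implicit Types a b q r s t x : R.

(** Convexity of the power [r^-1 >= 1] at the points [s]^ r[and]t [^ r], raised back to the power
    [r]. *)
Lemma powR_concave r a s t : 0 < r <= 1 -> 0 <= a <= 1 -> 0 <= s -> 0 <= t ->
  a * s `^ r + (1 - a) * t `^ r <= (a * s + (1 - a) * t) `^ r.
Proof.
move=> /andP[r0 r1] /andP[a0 a1] s0 t0.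
have rV1 : 1 <= r^-1 by rewrite invf_ge1.
have H : (a * s `^ r + (1 - a) * t `^ r) `^ r^-1 <= a * s + (1 - a) * t.
  have := @convex_powR R _ rV1 (Itv01 a0 a1) (s `^ r) (t `^ r).
  rewrite !inE/= !in_itv/= !powR_ge0 !convRE/= /unstable.onem => /(_ isT isT).
  by rewrite -!powRrM mulfV ?gt_eqF// !powRr1.
have u0 : 0 <= a * s `^ r + (1 - a) * t `^ r.
  by rewrite addr_ge0// mulr_ge0 ?powR_ge0// subr_ge0.
rewrite -[leLHS]powRr1// -[X in _ `^ X](mulVf (lt0r_neq0 r0)) powRrM.
apply: ge0_ler_powR => //; rewrite ?nnegrE ?powR_ge0//; first exact: ltW.
by rewrite addr_ge0// mulr_ge0// subr_ge0.
Qed.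

(** After taking logarithms, this is concavity of [ln] between 1 and [1 + x]. *)
Lemma powR_Bernoulli r x : 0 <= r <= 1 -> 0 <= x -> (1 + x) `^ r <= 1 + r * x.
Proof.
move=> /andP[r0 r1] x0.
have x1 : 0 < 1 + x by lra.
have y1 : 0 < 1 + r * x by have := mulr_ge0 r0 x0; lra.
rewrite -ler_ln ?posrE ?powR_gt0// ln_powR.
have := @concave_ln R (Itv01 r0 r1) (1 + x) 1 x1 ltr01.
rewrite !convRE/= ln1 mulr0 addr0 /unstable.onem.
by have -> : r * (1 + x) + (1 - r) * 1 = 1 + r * x by ring.
Qed.

Lemma powR_sqr x q : (x ^+ 2) `^ (q / 2) = `|x| `^ q.
Proof.
rewrite -real_normK ?num_real// -powR_mulrn// -powRrM.
by rewrite mulrCA mulfV ?mulr1// pnatr_eq0.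
Qed.

(** Homogeneity reduces to [a = 1] and [t = b / a]. Bernoulli then linearizes the left side to
    [2 + q * (q - 1) * t ^+ 2], the lower bound already known for the right side. *)
Lemma powR_two_point_ord q a b : 1 < q <= 2 -> 0 <= b <= a ->
  2 * (a ^+ 2 + (q - 1) * b ^+ 2) `^ (q / 2) <= (a + b) `^ q + (a - b) `^ q.
Proof.
move=> /andP[q1 q2] /andP[b0 ba].
have q0 : 0 < q by lra.
have := le_trans b0 ba; rewrite le_eqVlt => /predU1P[a0|a0].
  have -> : b = 0 by apply/eqP; rewrite eq_le b0 andbT a0.
  by rewrite -a0 expr0n/= mulr0 addr0 subr0 !powR0 ?gt_eqF ?divr_gt0// !mulr0 addr0.
pose t := b / a.
have t0 : 0 <= t by rewrite divr_ge0// ltW.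
have t1 : t <= 1 by rewrite ler_pdivrMr// mul1r.
have bE : b = a * t by rewrite mulrC divfK// gt_eqF.
have -> : a ^+ 2 + (q - 1) * b ^+ 2 = a ^+ 2 * (1 + (q - 1) * t ^+ 2).
  by rewrite bE; ring.
have -> : a + b = a * (1 + t) by rewrite bE; ring.
have -> : a - b = a * (1 - t) by rewrite bE; ring.
have s0 : 0 <= (q - 1) * t ^+ 2 by rewrite mulr_ge0 ?sqr_ge0//; lra.
have pos2 : 0 <= 1 + (q - 1) * t ^+ 2 by lra.
have posD : 0 <= 1 + t by lra.
have posB : 0 <= 1 - t by lra.
rewrite (powRM _ (sqr_ge0 a) pos2) (powRM _ (ltW a0) posD) (powRM _ (ltW a0) posB).
rewrite powR_sqr gtr0_norm// mulrCA -mulrDr ler_wpM2l ?powR_ge0//.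
have /(@powR_Bernoulli (q / 2)) H := s0.
have := @powR_two_point_le1 R q t; rewrite q1 q2 t0 t1 => /(_ isT isT).
by apply: le_trans; have := H ltac:(apply/andP; split; lra); lra.
Qed.

Lemma powR_two_point q a b : 1 < q <= 2 ->
  2 * (a ^+ 2 + (q - 1) * b ^+ 2) `^ (q / 2) <= `|a + b| `^ q + `|a - b| `^ q.
Proof.
move=> q12; have /andP[q1 q2] := q12.
wlog a0 : a b / 0 <= a.
  move=> H; have [/H//|a0] := leP 0 a.
  have := H (- a) (- b) ltac:(lra).
  by rewrite !sqrrN -!opprD !normrN.
wlog b0 : b / 0 <= b.
  move=> H; have [/H//|b0] := leP 0 b.
  have := H (- b) ltac:(lra).
  by rewrite !sqrrN opprK [leRHS]addrC.
rewrite (ger0_norm (addr_ge0 a0 b0)).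
have [ba|ab] := leP b a.
  by rewrite ger0_norm ?subr_ge0// powR_two_point_ord// b0.
rewrite distrC (@ger0_norm _ (b - a)) ?[a + b]addrC; last by rewrite subr_ge0 ltW.
(* For [a < b], exchanging the two only increases the left side: its base grows by
   [(2 - q) * (b ^+ 2 - a ^+ 2)]. *)
apply: le_trans (@powR_two_point_ord q b a q12 _); last by rewrite a0 ltW.
have ab2 : a ^+ 2 <= b ^+ 2 by rewrite lerXn2r ?nnegrE// ltW.
have sa := sqr_ge0 a; have sb := sqr_ge0 b.
have k0 : 0 <= q - 1 by lra.
have ka := mulr_ge0 k0 sa; have kb := mulr_ge0 k0 sb.
rewrite ler_wpM2l// ge0_ler_powR ?nnegrE//; [lra|lra|lra|].
have : 0 <= (2 - q) * (b ^+ 2 - a ^+ 2) by apply: mulr_ge0; lra.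
lra.
Qed.
End PowerMean.

(** * Uniform convexity of the l_q norm *)

Section Lnorm.
Context {R : realType}.
Variables (d : nat).
Implicit Types (q : R) (u v x y : 'I_d -> R).

Lemma lnorm_ge0 q v : 0 <= lnorm q v.
Proof. exact: powR_ge0. Qed.

Lemma lnorm_powR q v : 0 < q -> lnorm q v `^ q = \sum_i `|v i| `^ q.
Proof.
move=> q0; rewrite /lnorm -powRrM mulVf ?gt_eqF// powRr1//.
by rewrite sumr_ge0// => i _; exact: powR_ge0.
Qed.

Lemma lnorm_eq0 q v : 0 < q -> lnorm q v = 0 -> forall i, v i = 0.
Proof.
move=> q0 v0 i; have := lnorm_powR v q0.
rewrite v0 powR0 ?gt_eqF// => /esym/eqP.
rewrite psumr_eq0 => [|j _]; last exact: powR_ge0.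
by move=> /allP/(_ i (mem_index_enum _))/= /eqP /powR_eq0_eq0 /normr0_eq0.
Qed.

Lemma lnormZ q c v : 0 < q -> lnorm q (fun i => c * v i) = `|c| * lnorm q v.
Proof.
move=> q0; rewrite /lnorm; under eq_bigr do rewrite normrM powRM//.
rewrite -mulr_sumr powRM ?powR_ge0//; last first.
  by rewrite sumr_ge0// => i _; exact: powR_ge0.
by rewrite -powRrM mulfV ?gt_eqF// powRr1.
Qed.

(** Reverse Minkowski inequality for the exponent [q / 2 <= 1], applied to the squares of the
    coordinates. Vanishing norms are treated first because the general case normalizes by them. *)
Lemma lnorm_sqr_ge q x y : 1 < q <= 2 ->
  (lnorm q x ^+ 2 + (q - 1) * lnorm q y ^+ 2) `^ (q / 2) <=
  \sum_i (x i ^+ 2 + (q - 1) * y i ^+ 2) `^ (q / 2).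
Proof.
move=> /andP[q1 q2]; have q0 : 0 < q by lra.
have k0 : 0 < q - 1 by lra.
move: (q - 1) k0 => k k0.
move: (lnorm q x) (lnorm_ge0 q x) (lnorm_powR x q0) (@lnorm_eq0 q x q0)
  => X X0 XE X_eq0.
move: (lnorm q y) (lnorm_ge0 q y) (lnorm_powR y q0) (@lnorm_eq0 q y q0)
  => Y Y0 YE Y_eq0.
have := X0; rewrite le_eqVlt => /predU1P[/esym Xz|Xgt0].
  rewrite Xz expr0n/= add0r (powRM _ (ltW k0) (sqr_ge0 _)) powR_sqr (ger0_norm Y0).
  rewrite YE mulr_sumr ler_sum// => i _.
  rewrite (X_eq0 Xz) expr0n/= add0r (powRM _ (ltW k0) (sqr_ge0 _)).
  by rewrite powR_sqr.
have := Y0; rewrite le_eqVlt => /predU1P[/esym Yz|Ygt0].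
  rewrite Yz expr0n/= mulr0 addr0 powR_sqr (ger0_norm X0).
  rewrite XE ler_sum// => i _.
  by rewrite (Y_eq0 Yz) expr0n/= mulr0 addr0 powR_sqr.
have XX0 : 0 < X ^+ 2 by rewrite exprn_gt0.
have kY0 : 0 < k * Y ^+ 2 by rewrite mulr_gt0 ?exprn_gt0.
have U0 := addr_gt0 XX0 kY0.
have [U UE] : exists U, U = X ^+ 2 + k * Y ^+ 2 by eexists.
rewrite -UE in U0 *.
(* With [a] the share of [X ^+ 2] in [U], each summand is [U] times a convex combination of squared
   normalized coordinates. Concavity of the power [q / 2] applies, and the normalized q-th powers
   sum to 1. *)
have [a aE] : exists a, a = X ^+ 2 / U by eexists.
have a0 : 0 <= a by rewrite aE; apply: divr_ge0; exact: ltW.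
have a1 : a <= 1 by rewrite aE ler_pdivrMr// mul1r UE lerDl ltW.
have aC : 1 - a = k * Y ^+ 2 / U.
  by rewrite aE -[1](mulfV (lt0r_neq0 U0)) -mulrBl UE addrAC subrr add0r.
have normalized i : U `^ (q / 2) * (a * (`|x i| `^ q / X `^ q)
    + (1 - a) * (`|y i| `^ q / Y `^ q)) <= (x i ^+ 2 + k * y i ^+ 2) `^ (q / 2).
  have -> : x i ^+ 2 + k * y i ^+ 2 =
      U * (a * (x i / X) ^+ 2 + (1 - a) * (y i / Y) ^+ 2).
    by rewrite aC aE; field; rewrite !gt_eqF.
  have c0 : 0 <= a * (x i / X) ^+ 2 + (1 - a) * (y i / Y) ^+ 2.
    by rewrite addr_ge0// mulr_ge0 ?sqr_ge0// subr_ge0.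
  rewrite (powRM _ (ltW U0) c0).
  have nE z Z : 0 < Z -> `|z| `^ q / Z `^ q = ((z / Z) ^+ 2) `^ (q / 2).
    move=> Z0; rewrite powR_sqr normrM powRM// (gtr0_norm (x := Z^-1)) ?invr_gt0//.
    by rewrite -(powR_inv1 (ltW Z0)) -powRrM mulN1r powRN.
  rewrite ler_wpM2l ?powR_ge0// !nE//.
  by apply: powR_concave; rewrite ?sqr_ge0//; apply/andP; split; lra.
apply: le_trans (ler_sum _ (fun i _ => normalized i)).
rewrite -mulr_sumr big_split/= -!mulr_sumr -!mulr_suml -XE -YE.
by rewrite !mulfV ?gt_eqF ?powR_gt0// !mulr1 subrKC mulr1.
Qed.

(* 2-uniform convexity of l_q with the sharp constant (Ball, Carlen, Lieb). *)
Lemma lnorm_uniform_convex q x y : 1 < q <= 2 ->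
  lnorm q x ^+ 2 + (q - 1) * lnorm q y ^+ 2 <=
  (lnorm q (fun i => x i + y i) ^+ 2 + lnorm q (fun i => x i - y i) ^+ 2) / 2.
Proof.
move=> q12; have /andP[q1 q2] := q12; have q0 : 0 < q by lra.
have half : 1 - 2^-1 = 2^-1 :> R by lra.
have half01 : 0 <= (2^-1 : R) <= 1 by apply/andP; split; lra.
have q2_01 : 0 < q / 2 <= 1 by apply/andP; split; lra.
have lhs0 : 0 <= lnorm q x ^+ 2 + (q - 1) * lnorm q y ^+ 2.
  by apply: addr_ge0; rewrite ?sqr_ge0//; apply: mulr_ge0; rewrite ?sqr_ge0//; lra.
move: (lnorm q (fun i => x i + y i)) (lnorm_ge0 q (fun i => x i + y i))
  (lnorm_powR (fun i => x i + y i) q0) => A A0 AE.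
move: (lnorm q (fun i => x i - y i)) (lnorm_ge0 q (fun i => x i - y i))
  (lnorm_powR (fun i => x i - y i) q0) => B B0 BE.
(* The comparison is made after raising to the power [q / 2], where [lnorm_sqr_ge], the two-point
   inequality in each coordinate and concavity chain together. *)
rewrite leNgt; apply/negP => lt_rhs.
have : ((A ^+ 2 + B ^+ 2) / 2) `^ (q / 2) <
    (lnorm q x ^+ 2 + (q - 1) * lnorm q y ^+ 2) `^ (q / 2).
  apply: gt0_ltr_powR; rewrite ?nnegrE ?divr_gt0//.
  by rewrite divr_ge0// addr_ge0// sqr_ge0.
apply/negP; rewrite -leNgt; apply: (le_trans (lnorm_sqr_ge x y q12)).
have := @powR_concave R (q / 2) 2^-1 (A ^+ 2) (B ^+ 2).
move=> /(_ q2_01 half01 (sqr_ge0 _) (sqr_ge0 _)).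
rewrite half -(mulrDr _ (A ^+ 2)) [2^-1 * (A ^+ 2 + _)]mulrC; apply: le_trans.
rewrite !powR_sqr (ger0_norm A0) (ger0_norm B0) AE BE -mulrDr -big_split/=.
rewrite -ler_pdivrMl ?invr_gt0// invrK mulr_sumr ler_sum// => i _.
exact: powR_two_point.
Qed.

(** Uniform convexity at the midpoint and the half-difference of [u] and [v]; halving the difference
    produces the factor 1/4. *)
Lemma lnorm_midpoint_convex q x y u v : 1 < q <= 2 ->
  (forall i, x i = (u i + v i) / 2) -> (forall i, y i = u i - v i) ->
  lnorm q x ^+ 2 + (q - 1) * (lnorm q y ^+ 2 / 4) <=
  (lnorm q u ^+ 2 + lnorm q v ^+ 2) / 2.
Proof.
move=> q12 xE yE.
have [h hE] : exists h : 'I_d -> R, forall i, h i = 2^-1 * y i by eexists.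
have uE : u = (fun i => x i + h i).
  by apply/funext => i; rewrite hE xE yE; field.
have vE : v = (fun i => x i - h i).
  by apply/funext => i; rewrite hE xE yE; field.
have hn : lnorm q h ^+ 2 = lnorm q y ^+ 2 / 4.
  have -> : h = (fun i => 2^-1 * y i) by apply/funext.
  rewrite lnormZ; last by case/andP: q12 => q1 _; apply: lt_trans q1.
  by rewrite ger0_norm ?invr_ge0// exprMn; field.
by rewrite -hn uE vE; exact: lnorm_uniform_convex.
Qed.

End Lnorm.

(** * Hoelder's inequality *)

Section Hoelder.
Context {R : realType}.
Variables (d : nat) (p q : R).
Hypotheses (p0 : 0 < p) (q0 : 0 < q) (pq : p^-1 + q^-1 = 1).
Implicit Types u v : 'I_d -> R.

(** Young's inequality on the coordinates normalized by the two norms, summed; zero norms are set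
    apart to allow the division. *)
Lemma dotp_le_lnorm u v : `|dotp u v| <= lnorm p u * lnorm q v.
Proof.
apply: le_trans (ler_norm_sum _ _ _) _.
move: (lnorm p u) (lnorm_ge0 p u) (lnorm_powR u p0) (@lnorm_eq0 _ _ p u p0)
  => U U0 UE U_eq0.
move: (lnorm q v) (lnorm_ge0 q v) (lnorm_powR v q0) (@lnorm_eq0 _ _ q v q0)
  => V V0 VE V_eq0.
have := U0; rewrite le_eqVlt => /predU1P[/esym Uz|Ugt0].
  by rewrite Uz mul0r big1// => i _; rewrite (U_eq0 Uz) mul0r normr0.
have := V0; rewrite le_eqVlt => /predU1P[/esym Vz|Vgt0].
  by rewrite Vz mulr0 big1// => i _; rewrite (V_eq0 Vz) mulr0 normr0.
have young i : `|u i * v i| <=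
    U * V * (`|u i| `^ p / U `^ p / p + `|v i| `^ q / V `^ q / q).
  have nE (z Z r : R) : 0 < Z -> `|z| `^ r / Z `^ r = (`|z| / Z) `^ r.
    move=> Z0; rewrite powRM ?invr_ge0 ?(ltW Z0)//.
    by rewrite -(powR_inv1 (ltW Z0)) -powRrM mulN1r powRN.
  have E : U * V * (`|u i| / U * (`|v i| / V)) = `|u i| * `|v i|.
    by field; rewrite !gt_eqF.
  rewrite normrM -E ler_wpM2l ?mulr_ge0// !nE//.
  by apply: conjugate_powR => //; rewrite divr_ge0.
apply: le_trans (ler_sum _ (fun i _ => young i)) _.
rewrite -mulr_sumr big_split/= -!mulr_suml -UE -VE.
by rewrite !mulfV ?gt_eqF ?powR_gt0// !mul1r pq mulr1.
Qed.

End Hoelder.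

(** * Quadratic growth of the two objectives away from their minimizers *)

Section QuadraticGrowth.
Context {R : realType}.

(* Iterating the midpoint inequality towards the minimizer [z] improves the
   constant from 1/4 to 1/4 + 1/8 + 1/16 + ... = 1/2. *)
Lemma midpoint_quadratic_growth (V : Type) (S : V -> Prop) (mid : V -> V)
    (f N : V -> R) (z : V) :
  (forall v, S v -> S (mid v)) -> (forall v, 0 <= N v) ->
  (forall v, S v -> f z <= f v) -> (forall v, N (mid v) = N v / 4) ->
  (forall v, S v -> f (mid v) <= (f v + f z) / 2 - N v / 8) ->
  forall v, S v -> f z + N v / 2 <= f v.
Proof.
move=> Smid N0 fz Nmid fmid v Sv.
(* After [k] midpoint steps the constant is [1 / 2 - 1 / 2 ^+ k.+1]; since [N] drops by 4 and the
   midpoint inequality is doubled, each step halves the defect. *)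
have dyadic k u : S u -> f z + N u / 2 - N u / 2 / 2 ^+ k <= f u.
  elim: k u => [|k IH] u Su; first by rewrite expr0 divr1 addrK fz.
  have := IH _ (Smid _ Su); have := fmid _ Su; rewrite Nmid exprS invfM.
  move: (N u) (f u) (f (mid u)) (f z) (2 ^+ k)^-1 => a b c e g; lra.
rewrite leNgt; apply/negP => lt_fv.
have e0 : 0 < f z + N v / 2 - f v by rewrite subr_gt0.
have := archi_boundP (divr_ge0 (N0 v) (ltW e0)).
move: (Num.bound _) => k; rewrite ltr_pdivrMr// => Nk.
have k2 : k%:R <= 2 ^+ k :> R by rewrite -natrX ler_nat ltnW// ltn_expl.
have := dyadic k v Sv; rewrite lerBlDr -lerBlDl ler_pdivlMr ?exprn_gt0//.
apply/negP; rewrite -ltNge.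
apply: lt_le_trans (ler_wpM2l (ltW e0) k2).
by rewrite [ltRHS]mulrC (le_lt_trans _ Nk)// ler_pdivrMr// ler_peMr// ler1n.
Qed.

Definition midpoint m (u v : 'I_m -> R) : 'I_m -> R := fun i => (u i + v i) / 2.

(** The scaling of the regularizer cancels the [q - 1] of uniform convexity, giving exactly the
    [N / 8] gain of the midpoint scheme. A loss affine along midpoints leaves this gain
    unchanged. *)
Lemma lnorm_argmin_growth d (q : R) (L : ('I_d -> R) -> R) z : 1 < q <= 2 ->
  (forall u v, L (midpoint u v) = (L u + L v) / 2) ->
  is_argmin (fun _ => True) (fun v => L v + (2 * (q - 1))^-1 * lnorm q v ^+ 2) z ->
  forall v, L z + (2 * (q - 1))^-1 * lnorm q z ^+ 2
            + lnorm q (fun i => v i - z i) ^+ 2 / 2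
          <= L v + (2 * (q - 1))^-1 * lnorm q v ^+ 2.
Proof.
move=> q12 Lmid [_ zmin] v; have /andP[q1 q2] := q12.
have q0 : 0 < q by lra.
have k0 : 0 < (2 * (q - 1))^-1 by rewrite invr_gt0; lra.
have kq : (2 * (q - 1))^-1 * (q - 1) = 1 / 2.
  by field; apply/eqP; lra.
move: ((2 * (q - 1))^-1) k0 kq zmin => k k0 kq zmin.
have [N NE] : exists N, N = fun v : 'I_d -> R => lnorm q (fun i => v i - z i) ^+ 2.
  by eexists.
suff : forall v, True -> L z + k * lnorm q z ^+ 2 + N v / 2 <= L v + k * lnorm q v ^+ 2.
  by move=> /(_ v I); rewrite NE.
apply: (midpoint_quadratic_growth (mid := fun u => midpoint u z)).
- by [].
- by move=> u; rewrite NE sqr_ge0.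
- exact: zmin.
- move=> u; rewrite NE.
  have -> : (fun i => midpoint u z i - z i) = (fun i => 2^-1 * (u i - z i)).
    by apply/funext => i; rewrite /midpoint; field.
  by rewrite lnormZ// ger0_norm ?invr_ge0// exprMn; field.
- move=> u _; rewrite Lmid.
  have : lnorm q (midpoint u z) ^+ 2 + (q - 1) * (N u / 4) <=
      (lnorm q u ^+ 2 + lnorm q z ^+ 2) / 2.
    by rewrite NE; exact: lnorm_midpoint_convex.
  clear -k0 kq.
  generalize (lnorm q u ^+ 2) (lnorm q z ^+ 2) (lnorm q (midpoint u z) ^+ 2)
    (N u) (L u) (L z) => A B M D a b.
  move=> /(ler_wpM2l (ltW k0)); rewrite mulrDr (mulrA k (q - 1)) kq.
  lra.
Qed.

(* The slope [c] stands for the total l_1 distance: with it, no Cauchy-Schwarz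
   step is needed when the inequality is summed over the coordinates. *)
Lemma entropy_midpoint (a b c : R) : 0 <= a -> 0 <= b ->
  2 * ((a + b) / 2 * ln ((a + b) / 2)) + `|a - b| * c / 2 - c ^+ 2 * ((a + b) / 2) / 4
  <= a * ln a + b * ln b.
Proof.
wlog ba : a b / b <= a.
  move=> H a0 b0; have [ba|/ltW ab] := leP b a; first exact: H.
  by rewrite distrC [a + b]addrC [leRHS]addrC; exact: H.
move=> a0 b0; rewrite ger0_norm ?subr_ge0//.
have := addr_ge0 a0 b0; rewrite le_eqVlt => /predU1P[ab0|ab0].
  have -> : a = 0 by lra.
  have -> : b = 0 by lra.
  by rewrite !mul0r; lra.
have [m mE] : exists m, m = (a + b) / 2 by eexists.
have m0 : 0 < m by rewrite mE; lra.
(* In these coordinates [a = m * (1 + t)] and [b = m * (1 - t)]. The entropy gain is at least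
   [m * t ^+ 2], and the claim reduces to [0 <= m * (t - c / 2) ^+ 2]. *)
have [t tE] : exists t, t = (a - b) / (a + b) by eexists.
have t0 : 0 <= t by rewrite tE divr_ge0 ?subr_ge0// ltW.
have t1 : t <= 1 by rewrite tE ler_pdivrMr// mul1r; lra.
have aE : a = m * (1 + t) by rewrite mE tE; field; rewrite gt_eqF.
have bE : b = m * (1 - t) by rewrite mE tE; field; rewrite gt_eqF.
rewrite -mE; clear mE tE ab0 ba a0 b0; rewrite {}aE {}bE.
have lnE s : 0 <= s -> m * s * ln (m * s) = m * s * ln m + m * (s * ln s).
  rewrite le_eqVlt => /predU1P[<-|s0]; first by rewrite !(mulr0, mul0r) addr0.
  by rewrite lnM ?posrE//; ring.
have := entropy_two_point_le1 (b := t); rewrite t0 t1 => /(_ isT).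
rewrite !lnE; [|lra..].
move: ((1 + t) * ln _) ((1 - t) * ln _) (ln m) => A B l /(ler_wpM2l (ltW m0)) AB.
have := mulr_ge0 (ltW m0) (sqr_ge0 (t - c / 2)).
nra.
Qed.

Definition l1dist n (P Q : 'I_n -> R) : R := \sum_i `|P i - Q i|.

Lemma KL_uniformE n (Q : 'I_n -> R) : simplex Q ->
  KL Q (@uniform R n) = \sum_i Q i * ln (Q i) + ln n%:R.
Proof.
move=> [Q0 Q1].
have -> : ln n%:R = (\sum_i Q i) * ln n%:R by rewrite Q1 mul1r.
rewrite mulr_suml -big_split/=; apply: eq_bigr => i _.
have n0 : (0 < n)%N by case: n i {Q0 Q1 Q} => [[]|].
case: eqP => [->|/eqP Qi0]; first by rewrite !mul0r addr0.
have Qgt0 : 0 < Q i by rewrite lt_def Qi0 Q0.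
by rewrite /uniform invrK lnM ?posrE ?ltr0n// mulrDr.
Qed.

(** This is strong convexity of the entropy for the l_1 norm, a counterpart of Pinsker's
    inequality. *)
Lemma KL_argmin_growth n (L : ('I_n -> R) -> R) P :
  (forall u v, L (midpoint u v) = (L u + L v) / 2) ->
  is_argmin (@simplex R n) (fun Q => L Q + KL Q (@uniform R n)) P ->
  forall Q, simplex Q ->
    L P + KL P (@uniform R n) + l1dist Q P ^+ 2 / 2 <= L Q + KL Q (@uniform R n).
Proof.
move=> Lmid [SP Pmin] Q SQ.
have simplex_mid (u : 'I_n -> R) : simplex u -> simplex (midpoint u P).
  move=> [u0 u1]; case: SP => P0 P1; split=> [i|].
    by rewrite /midpoint divr_ge0// addr_ge0.
  by rewrite /midpoint -mulr_suml big_split/= u1 P1; lra.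
have Nmid (u : 'I_n -> R) : l1dist (midpoint u P) P ^+ 2 = l1dist u P ^+ 2 / 4.
  have -> : l1dist (midpoint u P) P = l1dist u P / 2.
    rewrite /l1dist mulr_suml; apply: eq_bigr => i _; rewrite /midpoint.
    have -> : (u i + P i) / 2 - P i = (u i - P i) * 2^-1 by field.
    by rewrite normrM [X in _ * X]ger0_norm// invr_ge0.
  by field.
have fmid u : simplex u -> L (midpoint u P) + KL (midpoint u P) (@uniform R n) <=
    (L u + KL u (@uniform R n) + (L P + KL P (@uniform R n))) / 2
    - l1dist u P ^+ 2 / 8.
  move=> Su.
  (* With slope [c = l1dist u P] the two correction terms sum to [c ^+ 2 / 2 - c ^+ 2 / 4], because
     the midpoint has total mass 1. Halving gives [c ^+ 2 / 8]. *)
  have := ler_sum (index_enum 'I_n) (fun i (_ : true) =>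
    entropy_midpoint (l1dist u P) (Su.1 i) (SP.1 i)).
  rewrite Lmid !KL_uniformE//; last exact: simplex_mid.
  rewrite big_split/= sumrN big_split/= -mulr_sumr -!mulr_suml -mulr_sumr.
  rewrite -mulr_suml !big_split/= Su.2 SP.2 -/(l1dist u P) /midpoint.
  generalize (\sum_i u i * ln (u i)) (\sum_i P i * ln (P i)) (l1dist u P) (L u)
    (L P) (ln (n%:R : R)) (\sum_i (u i + P i) / 2 * ln ((u i + P i) / 2)).
  move=> A B D a b l M.
  lra.
exact: (@midpoint_quadratic_growth _ (@simplex R n) (fun u => midpoint u P)
  (fun Q => L Q + KL Q (@uniform R n)) (fun u => l1dist u P ^+ 2) P
  simplex_mid (fun u => sqr_ge0 _) Pmin Nmid fmid Q SQ).
Qed.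

End QuadraticGrowth.

(** * The bilinear game and the regret of both players *)

Section Game.
Context {R : realType}.
Variables (d n : nat) (x : 'I_n -> 'I_d -> R) (y : 'I_n -> R).
Implicit Types (u v w : 'I_d -> R) (P Q : 'I_n -> R).

Lemma dotp_linear (a b : R) (z u v : 'I_d -> R) :
  dotp z (fun k => a * u k + b * v k) = a * dotp z u + b * dotp z v.
Proof.
rewrite /dotp !mulr_sumr -big_split/=; apply: eq_bigr => k _.
by rewrite mulrDr !(mulrCA (z k)).
Qed.

Lemma gfun_linear_l (a b : R) u v Q :
  gfun x y (fun k => a * u k + b * v k) Q = a * gfun x y u Q + b * gfun x y v Q.
Proof.
rewrite /gfun !mulr_sumr -big_split/=; apply: eq_bigr => i _.
by rewrite dotp_linear; ring.
Qed.

Lemma gfun_linear_r (a b : R) v P Q :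
  gfun x y v (fun i => a * P i + b * Q i) = a * gfun x y v P + b * gfun x y v Q.
Proof.
rewrite /gfun !mulr_sumr -big_split/=; apply: eq_bigr => i _.
by ring.
Qed.

Lemma gfun_midpoint_l u v Q :
  gfun x y (midpoint u v) Q = (gfun x y u Q + gfun x y v Q) / 2.
Proof.
have -> : midpoint u v = (fun k => 2^-1 * u k + 2^-1 * v k).
  by apply/funext => k; rewrite -mulrDr mulrC.
by rewrite gfun_linear_l -mulrDr mulrC.
Qed.

Lemma gfun_midpoint_r v P Q :
  gfun x y v (midpoint P Q) = (gfun x y v P + gfun x y v Q) / 2.
Proof.
have -> : midpoint P Q = (fun k => 2^-1 * P k + 2^-1 * Q k).
  by apply/funext => k; rewrite -mulrDr mulrC.
by rewrite gfun_linear_r -mulrDr mulrC.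
Qed.

Variables (p q : R).
Hypotheses (p0 : 0 < p) (q12 : 1 < q <= 2) (pq : p^-1 + q^-1 = 1).
Hypotheses (x1 : forall i, lnorm p (x i) <= 1).
Hypotheses (y1 : forall i, y i = 1 \/ y i = -1).

Let q0 : 0 < q. Proof. by case/andP: q12 => q1 _; apply: lt_trans q1. Qed.

(** By bilinearity the left side is the payoff of [u - v] against [P - Q], and Hoelder bounds each
    row by the l_q norm of [u - v]. It prices the prediction of one strategy by another. *)
Lemma gfun_diff_le u v P Q :
  (gfun x y u P - gfun x y u Q) - (gfun x y v P - gfun x y v Q) <=
  l1dist P Q * lnorm q (fun k => u k - v k).
Proof.
have -> : (gfun x y u P - gfun x y u Q) - (gfun x y v P - gfun x y v Q) =
    \sum_i (P i - Q i) * (y i * dotp (x i) (fun k => u k - v k)).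
  have dE i : dotp (x i) (fun k => u k - v k) = dotp (x i) u - dotp (x i) v.
    have -> : (fun k => u k - v k) = (fun k => 1 * u k + (-1) * v k).
      by apply/funext => k; rewrite mul1r mulN1r.
    by rewrite dotp_linear mul1r mulN1r.
  rewrite /gfun -!sumrB; apply: eq_bigr => i _; rewrite dE; ring.
rewrite /l1dist mulr_suml; apply: ler_sum => i _.
apply: le_trans (ler_norm _) _; rewrite !normrM ler_wpM2l//.
have -> : `|y i| = 1 by case: (y1 i) => ->; rewrite ?normrN normr1.
rewrite mul1r; apply: le_trans (dotp_le_lnorm p0 q0 pq _ _) _.
by rewrite ler_piMl// lnorm_ge0.
Qed.

Variables (w : nat -> 'I_d -> R) (P : nat -> 'I_n -> R) (T : nat).

(** Induction on [t] for all comparators at once: the hypothesis is used at the next iterate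
    [w t.+1], and growth around that minimizer passes to [v]. *)
Lemma optimistic_ftrl_regret (eta : R) : 0 < eta ->
  (forall t, (1 <= t <= T)%N ->
     is_argmin (fun _ => True)
       (fun v : 'I_d -> R =>
          eta * (\sum_(1 <= j < t) (- gfun x y v (P j)) + (- gfun x y v (P t.-1)))
          + (2 * (q - 1))^-1 * lnorm q v ^+ 2)
       (w t)) ->
  forall t, (t <= T)%N -> forall v,
  eta * \sum_(1 <= j < t.+1) gfun x y v (P j) - (2 * (q - 1))^-1 * lnorm q v ^+ 2 <=
  eta * \sum_(1 <= j < t.+1) gfun x y (w j) (P j)
  + eta ^+ 2 / 2 * \sum_(1 <= j < t.+1) l1dist (P j) (P j.-1) ^+ 2.
Proof.
move=> eta0 wmin.
(* The prediction error [eta * m * D] is absorbed by the growth term: [eta * m * D - D ^+ 2 / 2 <=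
   eta ^+ 2 * m ^+ 2 / 2]. *)
have step (Sv Sw B N gv1 gv0 gw1 gw0 Fv Fw D m : R) :
    gv1 - gv0 - (gw1 - gw0) <= m * D ->
    eta * Sw - Fw <= eta * B + eta ^+ 2 / 2 * N ->
    eta * (- Sw - gw0) + Fw + D ^+ 2 / 2 <= eta * (- Sv - gv0) + Fv ->
    eta * (Sv + gv1) - Fv <= eta * (B + gw1) + eta ^+ 2 / 2 * (N + m ^+ 2).
  clear -eta0 => /(ler_wpM2l (ltW eta0)) H1 H2 H3.
  have := sqr_ge0 (D - eta * m); lra.
elim=> [|t IH] tT v.
  rewrite !big_geq// !mulr0 addr0 sub0r oppr_le0.
  case/andP: q12 => q1 _; rewrite mulr_ge0 ?sqr_ge0// invr_ge0.
  by rewrite mulr_ge0// subr_ge0 ltW.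
have Lmid (u v' : 'I_d -> R) :
    eta * (\sum_(1 <= j < t.+1) (- gfun x y (midpoint u v') (P j))
           + (- gfun x y (midpoint u v') (P t))) =
    (eta * (\sum_(1 <= j < t.+1) (- gfun x y u (P j)) + (- gfun x y u (P t))) +
     eta * (\sum_(1 <= j < t.+1) (- gfun x y v' (P j)) + (- gfun x y v' (P t)))) / 2.
  have -> : \sum_(1 <= j < t.+1) (- gfun x y (midpoint u v') (P j)) =
      (\sum_(1 <= j < t.+1) (- gfun x y u (P j)) +
       \sum_(1 <= j < t.+1) (- gfun x y v' (P j))) / 2.
    rewrite -big_split/= mulr_suml; apply: eq_bigr => j _.
    by rewrite gfun_midpoint_l -mulNr opprD.
  by rewrite gfun_midpoint_l; field.
have H3 := lnorm_argmin_growth q12 Lmid (wmin t.+1 tT) v.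
have H2 := IH (ltnW tT) (w t.+1).
have H1 := gfun_diff_le v (w t.+1) (P t.+1) (P t).
rewrite !sumrN in H3; rewrite !(big_nat_recr t.+1)//=.
exact: (step _ _ _ _ _ _ _ _ _ _ _ _ H1 H2 H3).
Qed.

(** The player sees the current loss, so the leader is compared with itself: growth around [P t],
    evaluated at [P t.+1], supplies the negative squared distance, and the new loss is added to both
    sides. *)
Lemma be_the_leader_regret (eta : R) :
  P 0%N = @uniform R n -> (0 < n)%N ->
  (forall t, (1 <= t <= T)%N ->
     is_argmin (@simplex R n)
       (fun Q => eta * (\sum_(1 <= s < t.+1) gfun x y (w s) Q) + KL Q (@uniform R n))
       (P t)) ->
  forall t, (t <= T)%N -> forall Q, simplex Q ->
  eta * \sum_(1 <= s < t.+1) gfun x y (w s) (P s)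
  + (\sum_(1 <= s < t.+1) l1dist (P s) (P s.-1) ^+ 2) / 2 <=
  eta * \sum_(1 <= s < t.+1) gfun x y (w s) Q + KL Q (@uniform R n).
Proof.
move=> P0 n0 Pmin.
have nR0 : 0 < n%:R :> R by rewrite ltr0n.
have sum_uniform : \sum_(i < n) n%:R^-1 = 1 :> R.
  by rewrite sumr_const card_ord -[LHS]mulr_natr mulVf// gt_eqF.
(* Gibbs' inequality, from [ln u <= u - 1] at [u = (Q i * n%:R)^-1]. *)
have KL_ge0 Q : simplex Q -> 0 <= KL Q (@uniform R n).
  move=> SQ; have [Q0 Q1] := SQ; rewrite KL_uniformE//.
  have -> : ln n%:R = \sum_i Q i * ln (n%:R : R) by rewrite -mulr_suml Q1 mul1r.
  rewrite -big_split/=.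
  apply: (@le_trans _ _ (\sum_i (Q i - n%:R^-1))).
    by rewrite sumrB Q1 sum_uniform subrr.
  apply: ler_sum => i _.
  have := Q0 i; rewrite le_eqVlt => /predU1P[<-|Qi0].
    by rewrite !mul0r addr0 sub0r oppr_le0 invr_ge0 ltW.
  have u0 : 0 < Q i * n%:R by rewrite mulr_gt0.
  rewrite -mulrDr -lnM ?posrE// -[leRHS]opprK -mulrN -lnV ?posrE//.
  have := @le_ln1Dx R ((Q i * n%:R)^-1 - 1).
  rewrite subrKC => H; have {}H : ln (Q i * n%:R)^-1 <= (Q i * n%:R)^-1 - 1.
    by apply: H; rewrite -subr_gt0 opprK subrK invr_gt0.
  have := ler_wpM2l (ltW Qi0) H.
  have -> : Q i * ((Q i * n%:R)^-1 - 1) = n%:R^-1 - Q i.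
    by field; rewrite !gt_eqF.
  by rewrite -lerN2 opprB.
(* Round 0 is included: with an empty loss sum the uniform start minimizes the divergence alone, so
   growth also covers the move from [P 0] to [P 1]. *)
have Pmin0 t : (t <= T)%N -> is_argmin (@simplex R n)
    (fun Q => eta * (\sum_(1 <= s < t.+1) gfun x y (w s) Q) + KL Q (@uniform R n))
    (P t).
  case: t => [|t] tT; last exact: Pmin.
  have SU : simplex (@uniform R n).
    split=> [i|]; first by rewrite invr_ge0 ltW.
    exact: sum_uniform.
  rewrite P0; split=> // Q SQ; rewrite !big_geq// !mulr0 !add0r.
  suff -> : KL (@uniform R n) (@uniform R n) = 0 by exact: KL_ge0.
  rewrite /KL big1// => i _; case: ifP => // /negbT u0.
  by rewrite mulfV// ln1 mulr0.
have step (A B C D E F G H : R) : eta * A + B / 2 <= eta * C + E ->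
    eta * C + E + G / 2 <= eta * D + F ->
    eta * (A + H) + (B + G) / 2 <= eta * (D + H) + F by lra.
(* The induction runs with the leader [P t] as comparator; minimality then passes to any [Q]. *)
suff main t : (t <= T)%N ->
    eta * \sum_(1 <= s < t.+1) gfun x y (w s) (P s)
    + (\sum_(1 <= s < t.+1) l1dist (P s) (P s.-1) ^+ 2) / 2 <=
    eta * \sum_(1 <= s < t.+1) gfun x y (w s) (P t) + KL (P t) (@uniform R n).
  move=> t tT Q SQ; apply: le_trans (main t tT) _.
  exact: (Pmin0 t tT).2.
elim: t => [|t IH] tT.
  rewrite !big_geq// !mulr0 mul0r !add0r; apply: KL_ge0.
  exact: (Pmin0 0%N tT).1.
have Lmid (u v : 'I_n -> R) :
    eta * (\sum_(1 <= s < t.+1) gfun x y (w s) (midpoint u v)) =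
    (eta * (\sum_(1 <= s < t.+1) gfun x y (w s) u) +
     eta * (\sum_(1 <= s < t.+1) gfun x y (w s) v)) / 2.
  rewrite -mulrDr -mulrA -big_split/= mulr_suml; congr (_ * _).
  by apply: eq_bigr => j _; rewrite gfun_midpoint_r.
have H2 := KL_argmin_growth Lmid (Pmin0 t (ltnW tT)) (Pmin0 t.+1 tT).1.
have H1 := IH (ltnW tT).
rewrite !(big_nat_recr t.+1)//=.
exact: (step _ _ _ _ _ _ _ _ H1 H2).
Qed.

End Game.

(** * Vertices of the simplex, against which the payoff is a single margin *)

Section Vertex.
Context {R : realType}.
Variables (n : nat) (i : 'I_n).

Definition vertex : 'I_n -> R := fun j => (j == i)%:R.

Lemma simplex_vertex : simplex vertex.
Proof.
split=> [j|]; first by rewrite /vertex ler0n.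
by rewrite (bigD1 i)//= /vertex eqxx big1 ?addr0// => j /negPf ->.
Qed.

Lemma KL_vertex : KL vertex (@uniform R n) = ln n%:R.
Proof.
rewrite KL_uniformE; last exact: simplex_vertex.
rewrite big1 ?add0r// => j _; rewrite /vertex.
by case: eqP => _; rewrite ?mul0r ?ln1 ?mulr0.
Qed.

Lemma gfun_vertex d (x : 'I_n -> 'I_d -> R) (y : 'I_n -> R) v :
  gfun x y v vertex = y i * dotp (x i) v.
Proof.
rewrite /gfun (bigD1 i)//= /vertex eqxx mul1r big1 ?addr0// => j /negPf ->.
by rewrite mul0r.
Qed.

End Vertex.

Theorem theorem7 (R : realType) :
  exists C : R, 0 < C /\
  forall (p q : R) (d n : nat) (x : 'I_n -> 'I_d -> R) (y : 'I_n -> R)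
         (wstar : 'I_d -> R) (gamma : R)
         (w : nat -> 'I_d -> R) (P : nat -> 'I_n -> R) (T : nat),
    2 <= p -> 1 < q -> q <= 2 -> p^-1 + q^-1 = 1 ->
    (2 <= n)%N ->
    (forall i, lnorm p (x i) <= 1) ->
    (forall i, y i = 1 \/ y i = -1) ->
    lnorm q wstar <= 1 ->
    0 < gamma ->
    (forall i, gamma <= y i * dotp (x i) wstar) ->
    let etaw := Num.sqrt (1 / (2 * (q - 1) * ln (n%:R))) in
    let etap := etaw^-1 in
    P 0%N = @uniform R n ->
    (forall t, (1 <= t <= T)%N ->
       is_argmin (fun _ => True)
         (fun v : 'I_d -> R =>
            etaw * (\sum_(1 <= j < t) (- gfun x y v (P j))
                    + (- gfun x y v (P t.-1)))
            + (2 * (q - 1))^-1 * lnorm q v ^+ 2)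
         (w t)
       /\
       is_argmin (@simplex R n)
         (fun Q : 'I_n -> R =>
            etap * (\sum_(1 <= s < t.+1) gfun x y (w s) Q) + KL Q (@uniform R n))
         (P t)) ->
    C * Num.sqrt (2 * (p - 1) * ln (n%:R)) / gamma <= T%:R ->
    forall i, 0 <= y i * dotp (x i)
                 (fun k => (T%:R)^-1 * \sum_(1 <= s < T.+1) w s k).
Proof.
exists 1; split=> // p q d n x y wstar gamma w P T p2 q1 q2 pq n2 x1 y1 ws1 g0 margin.
move=> etaw etap P0 opt; rewrite mul1r => Tge i.
have p0 : 0 < p by apply: lt_le_trans p2.
have q12 : 1 < q <= 2 by rewrite q1 q2.
have n1 : (1 : R) < n%:R by rewrite ltr1n.
have l0 : 0 < ln (n%:R : R) by exact: ln_gt0.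
have k0 : 0 < q - 1 by rewrite subr_gt0.
have pE : p - 1 = (q - 1)^-1.
  have qN0 : q != 0 by rewrite gt_eqF// (lt_trans _ q1).
  have qB0 : q - 1 != 0 by rewrite gt_eqF.
  have -> : p = (1 - q^-1)^-1 by rewrite -pq addrK invrK.
  by field; rewrite qN0 qB0.
have eta0 : 0 < etaw by rewrite sqrtr_gt0 divr_gt0// !mulr_gt0.
have eta2 : etaw ^+ 2 = 1 / (2 * (q - 1) * ln n%:R).
  by rewrite sqr_sqrtr// divr_ge0// !mulr_ge0// ltW.
(* The threshold on [T] times [etaw]: by conjugacy [etaw] times the square root is [(q - 1)^-1].
   This pays for two terms of at most half that size, the regularizer at [wstar] and
   [etaw ^+ 2 * ln n%:R]. *)
have T_ge_eta : (q - 1)^-1 <= etaw * (T%:R * gamma).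
  move: Tge; rewrite ler_pdivrMr// => Tge.
  apply: le_trans (ler_wpM2l (ltW eta0) Tge).
  rewrite /etaw -sqrtrM; last by rewrite divr_ge0// !mulr_ge0// ltW.
  rewrite pE.
  have -> : 1 / (2 * (q - 1) * ln n%:R) * (2 * (q - 1)^-1 * ln n%:R) =
      ((q - 1)^-1) ^+ 2.
    by field; rewrite !gt_eqF.
  by rewrite sqrtr_sqr ger0_norm// invr_ge0 ltW.
clearbody etaw; subst etap.
have wregret := optimistic_ftrl_regret p0 q12 pq x1 y1 eta0
  (fun t tT => (opt t tT).1) (leqnn T) wstar.
have pregret := be_the_leader_regret P0 (ltnW n2) (fun t tT => (opt t tT).2)
  (leqnn T) (simplex_vertex i).
rewrite KL_vertex in pregret.
(* Each [P j] is a probability vector, so it averages margins of [wstar] that are all at least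
   [gamma]. *)
have marginT : T%:R * gamma <= \sum_(1 <= j < T.+1) gfun x y wstar (P j).
  have -> : T%:R * gamma = \sum_(1 <= j < T.+1) gamma.
    by rewrite sumr_const_nat subSS subn0 mulr_natl.
  apply: ler_sum_nat => j; rewrite ltnS => jT.
  have [Pj0 Pj1] := (opt j jT).2.1.
  rewrite -[gamma]mul1r -Pj1 mulr_suml /gfun; apply: ler_sum => m _.
  by rewrite ler_wpM2l.
have wsn : (2 * (q - 1))^-1 * lnorm q wstar ^+ 2 <= (q - 1)^-1 / 2.
  have ws2 : lnorm q wstar ^+ 2 <= 1 by rewrite expr_le1 ?lnorm_ge0.
  have k2 : 0 <= (2 * (q - 1))^-1 by rewrite invr_ge0 mulr_ge0// ltW.
  by apply: le_trans (ler_wpM2l k2 ws2) _; rewrite mulr1 invfM mulrC.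
have eta2l : etaw ^+ 2 * ln n%:R = (q - 1)^-1 / 2.
  by rewrite eta2; field; rewrite !gt_eqF.
(* Multiplying the second bound by [etaw ^+ 2] makes its left side equal to the right side of the
   first, so [B] and [N] disappear together. *)
have combine (Z A B N V F l K : R) :
    etaw * Z - F <= etaw * B + etaw ^+ 2 / 2 * N ->
    etaw^-1 * B + N / 2 <= etaw^-1 * V + l ->
    A <= Z -> K <= etaw * A -> F <= K / 2 -> etaw ^+ 2 * l = K / 2 -> 0 <= V.
  clear -eta0 => HZ /(ler_wpM2l (sqr_ge0 etaw)).
  have etaK C : etaw ^+ 2 * (etaw^-1 * C) = etaw * C.
    by rewrite expr2 -mulrA mulVKf// gt_eqF.
  rewrite !(mulrDr (etaw ^+ 2)) !etaK => HV /(ler_wpM2l (ltW eta0)) HA HK HF Hl.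
  by rewrite -(pmulr_rge0 _ eta0); lra.
have sum0 := combine _ _ _ _ _ _ _ _ wregret pregret marginT T_ge_eta wsn eta2l.
have -> : y i * dotp (x i) (fun k => T%:R^-1 * \sum_(1 <= s < T.+1) w s k) =
    T%:R^-1 * \sum_(1 <= s < T.+1) gfun x y (w s) (vertex i).
  under [in RHS]eq_bigr do rewrite gfun_vertex.
  rewrite -mulr_sumr mulrCA; congr (_ * _).
  rewrite /dotp exchange_big/= mulr_sumr; apply: eq_bigr => k _.
  by rewrite -mulr_sumr mulrCA.
by rewrite mulr_ge0// invr_ge0 ler0n.
Qed.
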